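(* For $j=1$ or $j=2$ and every integer $n\ge 0$, $$\sum_{k=0}^{n}(-1)^{k}\det\begin{pmatrix} M_{n,k}(2,2) & M_{n,k+1}(2,2)\\ M_{n+j,k}(2,2) & M_{n+j,k+1}(2,2)\end{pmatrix}=4^{j-1}C_{n+1};$$ or equivalently, for $j=1$, $$C_{n+1}=\sum_{k=0}^{n}(-1)^k\frac{(2k+2)(2k+3)(2k+4)}{(2n+2)(2n+3)(2n+4)^2}\binom{2n+4}{n-k}\binom{2n+4}{n-k+1},$$ and for $j=2$, $$2C_{n+1}=\sum_{k=0}^{n}(-1)^k\frac{(2k+2)(2k+3)(2k+4)}{(2n+2)(2n+3)(2n+6)(2n+7)}\binom{2n+3}{n-k}\binom{2n+7}{n-k+2}.$$
   Context: $C_n=\frac{1}{n+1}\binom{2n}{n}$ is the $n$-th Catalan number. A partial Motzkin path from $(0,0)$ to $(n,k)$ is a lattice path that never goes below the $X$-axis and consists of up steps $U=(1,1)$, down steps $D=(1,-1)$ and horizontal steps $H=(1,0)$. Every up step and every down step has weight $1$, every horizontal step lying on the $X$-axis has weight $x$, and every horizontal step not lying on the $X$-axis has weight $y$; the weight of a path is the product of the weights of its steps. $M_{n,k}(x,y)$ is the sum of the weights of all partial Motzkin paths from $(0,0)$ to $(n,k)$. Equivalently, $M_{0,0}(x,y)=1$, $M_{n,k}(x,y)=0$ if $n<k$ or $k<0$, $M_{n,0}(x,y)=xM_{n-1,0}(x,y)+M_{n-1,1}(x,y)$ for $n\ge1$, and $M_{n,k}(x,y)=M_{n-1,k-1}(x,y)+yM_{n-1,k}(x,y)+M_{n-1,k+1}(x,y)$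 for $n\ge k\ge 1$. $M_{n,k}(2,2)$ is the value at $x=y=2$; explicitly $M_{n,k}(2,2)=\frac{2k+2}{2n+2}\binom{2n+2}{n-k}$ for $n\ge k\ge 0$. *)

(* Defs.v *)
From HB Require Import structures.
From mathcomp Require Import all_boot all_order all_algebra.
Set Implicit Arguments. Unset Strict Implicit. Unset Printing Implicit Defensive.
Import Order.TTheory GRing.Theory Num.Theory.
Local Open Scope ring_scope.

(* Up step (1,1), down step (1,-1), horizontal step (1,0). *)
Inductive step := U | D | H.

Definition ord_of_step (s : step) : 'I_3 :=
  match s with U => inord 0 | D => inord 1 | H => inord 2 end.
Definition step_of_ord (i : 'I_3) : step :=
  match val i with 0%N => U | 1%N => D | _ => H end.
Fact ord_of_stepK : cancel ord_of_step step_of_ord.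
Proof. by case; rewrite /step_of_ord /= inordK. Qed.
HB.instance Definition _ := Finite.copy step (can_type ord_of_stepK).

Definition rise (s : step) : int :=
  match s with U => 1 | D => -1 | H => 0 end.

Definition height (p : seq step) : int := \sum_(s <- p) rise s.

(* All steps advance the abscissa by one, so that the paths from (0,0) to a
   point of abscissa n are the sequences of n steps; the point of abscissa i
   on the path p is (i, height (take i p)). *)
Definition partial_motzkin (n k : nat) (p : n.-tuple step) : bool :=
  [forall i : 'I_n.+1, 0 <= height (take i p)] && (height p == k%:Z).

Definition step_weight (R : comNzRingType) (x y : R) (h : int) (s : step) : R :=
  match s with
  | U | D => 1
  | H => if h == 0 then x else y
  end.

Definition path_weight (R : comNzRingType) (x y : R) (n : nat)
    (p : n.-tuple step) : R :=
  \prod_(i < n) step_weight x y (height (take i p)) (tnth p i).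

Definition M (R : comNzRingType) (n k : nat) (x y : R) : R :=
  \sum_(p : n.-tuple step | partial_motzkin k p) path_weight x y p.

Definition catalan (n : nat) : rat := 'C(2 * n, n)%:R / (n + 1)%:R.

Definition mx22 (R : Type) (a b c d : R) : 'M[R]_2 :=
  \matrix_(i, j) if i == 0 then (if j == 0 then a else b)
                 else (if j == 0 then c else d).

(* Main.v *)
(** Let [e_k] be the standard basis indexed by the naturals and let [A] be the
    adjacency operator of the half-line, so that [M n k 2 2] is the coordinate
    of [(2 + A)^n e_0] at [k]. For the skew form
    [w(u, v) = \sum_k (-1)^k (u_k v_{k+1} - u_{k+1} v_k)] one has
    [w(A u, v) = - w(u, A v)], hence the sum of determinants is
    [w((2 + A)^n e_0, (2 + A)^(n+j) e_0) = w(e_0, (4 - A^2)^n (2 + A)^j e_0)],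
    the coordinate at 1 of [(4 - A^2)^n (2 + A)^j e_0]. The operator [4 - A^2]
    preserves parity and acts on the odd coordinates, up to alternating signs,
    as [2 + A] acts on all of them; the odd part of [(2 + A)^j e_0] is
    [4^(j-1) e_1], so the sum is [4^(j-1) M n 0 2 2], a Catalan number times
    [4^(j-1)]. The binomial sums agree with it term by term through the closed
    form of [M n k 2 2]. *)

Require Import Defs.
From mathcomp Require Import all_boot all_order all_algebra.
From mathcomp Require Import zify ring.
Import Order.TTheory GRing.Theory Num.Theory.
Local Open Scope ring_scope.

(** * Recurrence for weighted path sums, by removing the last step *)

Lemma big_step (V : nmodType) (F : step -> V) :
  \sum_(s : step) F s = F U + F D + F H.
Proof.
rewrite (reindex_onto step_of_ord ord_of_step) => [|s _]; last exact: ord_of_stepK.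
rewrite (eq_bigl predT) => [|i]; last first.
  by apply/eqP/val_inj; case: i => [[|[|[|//]]] lti]; rewrite /= inordK.
by rewrite !big_ord_recr big_ord0 /= add0r.
Qed.

Lemma height_rcons (p : seq step) (s : step) :
  height (rcons p s) = height p + rise s.
Proof. by rewrite /height -cats1 big_cat big_seq1. Qed.

Lemma big_tuple_rcons (V : nmodType) (T : finType) (n : nat)
    (P : pred (n.+1.-tuple T)) (F : n.+1.-tuple T -> V) :
  \sum_(p : n.+1.-tuple T | P p) F p =
  \sum_(p : n.-tuple T) \sum_(s : T | P [tuple of rcons p s])
     F [tuple of rcons p s].
Proof.
rewrite pair_big_dep /=.
rewrite (reindex (fun q : n.-tuple T * T => [tuple of rcons q.1 q.2])) //=.
(* The inverse of [rcons]: all entries but the last, paired with the last one. *)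
pose g (p : n.+1.-tuple T) := ([tuple of belast (thead p) (behead p)], tnth p ord_max).
exists g => [[p s] _ | p _].
  congr pair; last first.
    by rewrite (tnth_nth s) /= nth_rcons size_tuple ltnn eqxx.
  apply: val_inj => /=.
  rewrite /thead (tnth_nth s) /=.
  by case: (tval p) => [//|x q] /=; rewrite belast_rcons.
apply: val_inj => /=.
case/tupleP: p => x p /=.
rewrite theadE (tnth_nth x) /= -[X in nth _ _ X](size_tuple p).
by rewrite nth_last /= -lastI.
Qed.

Definition nonneg_path {n : nat} (p : n.-tuple step) : bool :=
  [forall i : 'I_n.+1, 0 <= height (take i p)].

Lemma nonneg_path_height (n : nat) (p : n.-tuple step) :
  nonneg_path p -> 0 <= height p.
Proof. by move/forallP/(_ ord_max); rewrite /= take_oversize ?size_tuple. Qed.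

(** The endpoint has the natural number [k] as height, so only the points of [p] need checking for
    sign. *)
Lemma partial_motzkin_rcons (n k : nat) (p : n.-tuple step) (s : step) :
  partial_motzkin k [tuple of rcons p s] =
  nonneg_path p && (height p + rise s == k%:Z).
Proof.
rewrite /partial_motzkin /= height_rcons.
have [hk|] := eqVneq (height p + rise s) k; last by rewrite !andbF.
rewrite !andbT; apply/forallP/forallP => /= hp i.
  have := hp (widen_ord (leqnSn _) i).
  by rewrite /= -cats1 takel_cat // size_tuple -ltnS.
have [lti|] := ltnP i n.+1.
  have := hp (Ordinal lti).
  by rewrite /= -cats1 takel_cat // size_tuple -ltnS.
move=> lein; rewrite take_oversize; last by rewrite size_rcons size_tuple.
by rewrite height_rcons hk.
Qed.

Lemma path_weight_rcons (R : comNzRingType) (x y : R) (n : nat)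
    (p : n.-tuple step) (s : step) :
  path_weight x y [tuple of rcons p s] =
  path_weight x y p * step_weight x y (height p) s.
Proof.
rewrite /path_weight big_ord_recr /=; congr (_ * _).
  apply: eq_bigr => i _; rewrite !(tnth_nth s) /= nth_rcons -cats1.
  by rewrite takel_cat size_tuple ?ltn_ord // ltnW.
rewrite (tnth_nth s) /= nth_rcons size_tuple ltnn eqxx.
by rewrite -cats1 take_size_cat ?size_tuple.
Qed.

Lemma M0 (R : comNzRingType) (k : nat) (x y : R) : M 0 k x y = (k == 0)%:R.
Proof.
rewrite /M (eq_bigl (fun p => (k == 0) && (p == [tuple]))).
  case: eqP => /= _; last by rewrite big_pred0_eq.
  by rewrite big_pred1_eq /path_weight big_ord0.
move=> p; have -> : p = [tuple] by exact: tuple0.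
have h0 (s : seq step) : size s = 0%N -> height s = 0.
  by move/size0nil->; rewrite /height big_nil.
rewrite eqxx andbT /partial_motzkin h0 // eq_sym [RHS]/eq_op /=.
case: k => [|k] /=; last by rewrite andbF.
by rewrite andbT; apply/forallP.
Qed.

Lemma MS (R : comNzRingType) (n k : nat) (x y : R) :
  M n.+1 k x y = (if k is k'.+1 then M n k' x y else 0)
    + (if k == 0%N then x else y) * M n k x y + M n k.+1 x y.
Proof.
rewrite /M big_tuple_rcons.
under eq_bigr => p _.
  rewrite big_mkcond big_step !partial_motzkin_rcons !path_weight_rcons /=.
  over.
rewrite !big_split /= addrAC; congr (_ + _ + _); rewrite -big_mkcond.
- case: k => [|k].
    (* An up step ending on the axis would start at height -1. *)
    rewrite big_pred0 // => p; apply/negP=> /andP[/nonneg_path_height]; lia.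
  rewrite (eq_bigl (partial_motzkin k)); last first.
    by move=> p; rewrite /partial_motzkin -/(nonneg_path p); congr (_ && _); lia.
  by apply: eq_bigr => p _; rewrite mulr1.
- rewrite mulr_sumr; rewrite (eq_bigl (partial_motzkin k)); last first.
    by move=> p; rewrite /partial_motzkin -/(nonneg_path p) addr0.
  by apply: eq_bigr => p /andP[_ /eqP->]; rewrite mulrC.
rewrite (eq_bigl (partial_motzkin k.+1)); last first.
  by move=> p; rewrite /partial_motzkin -/(nonneg_path p); congr (_ && _); lia.
by apply: eq_bigr => p _; rewrite mulr1.
Qed.

(** * The half-line operator and the alternating skew form *)

Section AlternatingForm.
Variable R : comNzRingType.
Implicit Types u v p : {poly R}.

(* Finitely supported vectors are encoded as polynomials; [nbr] is [A]. *)
Definition nbr p : {poly R} := 'X * p + drop_poly 1 p.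

Lemma coef_nbr0 p : (nbr p)`_0 = p`_1.
Proof. by rewrite coefD coefXM coef_drop_poly add0r. Qed.

Lemma coef_nbrS p k : (nbr p)`_k.+1 = p`_k + p`_k.+2.
Proof. by rewrite coefD coefXM coef_drop_poly addn1. Qed.

Definition up p : {poly R} := p *+ 2 + nbr p.
Definition down p : {poly R} := p *+ 2 - nbr p.

Lemma coef_up0 p : (up p)`_0 = p`_0 *+ 2 + p`_1.
Proof. by rewrite coefD coefMn coef_nbr0. Qed.

Lemma coef_upS p k : (up p)`_k.+1 = p`_k + p`_k.+1 *+ 2 + p`_k.+2.
Proof. by rewrite coefD coefMn coef_nbrS; ring. Qed.

Lemma coef_down0 p : (down p)`_0 = p`_0 *+ 2 - p`_1.
Proof. by rewrite coefB coefMn coef_nbr0. Qed.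

Lemma coef_downS p k : (down p)`_k.+1 = p`_k.+1 *+ 2 - p`_k - p`_k.+2.
Proof. by rewrite coefB coefMn coef_nbrS; ring. Qed.

Lemma up_downC p : up (down p) = down (up p).
Proof.
apply/polyP=> -[|[|k]];
  by rewrite !(coef_up0, coef_upS, coef_down0, coef_downS); ring.
Qed.

(** The polynomial [1] is e_0, and the coefficient rules of [up] are the recurrence [MS] at x = y =
    2. *)
Lemma coef_iter_up n k : (iter n up 1)`_k = M n k 2 2.
Proof.
elim: n k => [|n IHn] k; first by rewrite M0 coef1.
rewrite iterS MS; case: k => [|k]; rewrite ?coef_up0 ?coef_upS !IHn /=; ring.
Qed.

Lemma coef_iter_up_gt n k : (n < k)%N -> (iter n up 1)`_k = 0.
Proof.
elim: n k => [|n IHn] [|k] // ltnk; first by rewrite coef1.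
by rewrite iterS coef_upS !IHn ?mul0rn ?addr0 //; lia.
Qed.

(** The form w cut off at [N]; nothing is lost when one argument has no coefficient from index [N]
    on. *)
Definition skew (N : nat) u v : R :=
  \sum_(0 <= k < N) (-1) ^+ k * (u`_k * v`_k.+1 - u`_k.+1 * v`_k).

(** Summation by parts: the multiples of 2 cancel and what is left of the difference telescopes. *)
Lemma skew_up n u v : u`_n = 0 -> u`_n.+1 = 0 -> u`_n.+2 = 0 ->
  skew n.+1 (up u) v = skew n.+1 u (down v).
Proof.
move=> un un1 un2; apply/eqP; rewrite -subr_eq0 /skew -sumrB; apply/eqP.
(* Up to the sign (-1)^k, [c] is the telescoping primitive. It is 0 at 0, and [c n.+1] vanishes
   because the coefficients of [u] at [n] and [n.+2] do. *)
pose c k := if k is k'.+1 then u`_k' * v`_k.+1 - u`_k.+1 * v`_k' else 0.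
rewrite (eq_bigr (fun k => - ((-1) ^+ k.+1 * c k.+1 - (-1) ^+ k * c k))).
  by rewrite sumrN telescope_sumr //= un un2; ring.
case=> [|k] _; rewrite /c !(coef_up0, coef_upS, coef_down0, coef_downS) ?exprS;
  ring.
Qed.

(** The hypothesis keeps every intermediate vector within the cutoff; for [u = 1] and [m = n] it
    holds because [iter i up 1] has degree at most [i]. *)
Lemma skew_iter_up n m u v :
  (forall i k, (i < m)%N -> (n <= k)%N -> (iter i up u)`_k = 0) ->
  skew n.+1 (iter m up u) v = skew n.+1 u (iter m down v).
Proof.
elim: m v => // m IHm v u0; rewrite iterS skew_up ?u0 //; try lia.
rewrite IHm -?iterSr // => i k lti; apply: u0; lia.
Qed.

Lemma skew1 n v : skew n.+1 1 v = v`_1.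
Proof.
rewrite /skew big_nat_recl // big1_seq ?addr0 => [|k _]; rewrite !coef1 /=; ring.
Qed.

Lemma iter_down_up n p :
  iter n down (iter n up p) = iter n (fun p => down (up p)) p.
Proof.
have downC m q : iter m down (up q) = up (iter m down q).
  by elim: m => //= m ->; rewrite up_downC.
by elim: n => //= n IHn; rewrite -iterS downC /= IHn up_downC.
Qed.

(* [down \o up] is [4 - nbr ^ 2], which acts on the odd-indexed coefficients,
   taken with alternating signs, as [up] acts on all coefficients. *)
Lemma coef_iter_down_up n p (c : R) :
  (forall k, p`_(k.*2.+1) = c *+ (k == 0%N)) -> forall k,
  (iter n (fun p => down (up p)) p)`_(k.*2.+1) = (-1) ^+ k * c * M n k 2 2.
Proof.
move=> pE; elim: n => [|n IHn] k.
  by rewrite pE M0; case: k => [|k] /=; rewrite ?expr0 ?mulr0 // mul1r mulr1.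
rewrite iterS MS; set q := iter n _ p in IHn *.
have := (IHn k, IHn k.+1); case: k => [|k] [].
  by rewrite !(coef_down0, coef_downS, coef_up0, coef_upS) /= => -> ->; ring.
move=> q1 q2; have q0 := IHn k.
rewrite doubleS !(coef_downS, coef_upS) -!doubleS q0 q1 q2 !exprS; ring.
Qed.

(** The shift [j] enters only through the odd part of [iter j up 1], which is [c] times e_1. *)
Lemma sum_det_M n j (c : R) :
  (forall k, (iter j up 1)`_(k.*2.+1) = c *+ (k == 0%N)) ->
  \sum_(0 <= k < n.+1) (-1) ^+ k *
     (M n k 2 2 * M (n + j) k.+1 2 2 - M n k.+1 2 2 * M (n + j) k 2 2)
  = c * M n 0 2 2.
Proof.
move=> cE; have := skew_iter_up n n 1 (iter (n + j) up 1).
(* The coefficient at 1 is the odd-indexed one with [k = 0]. *)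
rewrite skew1 iterD iter_down_up -[1%N]/(0.*2.+1) (coef_iter_down_up _ _ c) //.
rewrite mul1r => <- => [|i k lti lek]; last by apply: coef_iter_up_gt; lia.
by apply: eq_bigr => k _; rewrite -iterD !coef_iter_up.
Qed.

End AlternatingForm.

(** * Closed forms and the binomial summands *)

Lemma det_mx22 (R : comNzRingType) (a b c d : R) :
  \det (mx22 a b c d) = a * d - b * c.
Proof.
rewrite (expand_det_row _ 0) !big_ord_recl big_ord0 /cofactor !det_mx11 !mxE /=.
ring.
Qed.

(** A reflection formula: Pascal's rule applied twice gives the recurrence, and the difference
    vanishes at height -1 by symmetry. Indexing by [n + k] avoids truncated subtraction and covers
    [k > n]. *)
Lemma M22_bin n k :
  M n k 2 2 = 'C(n.*2, n + k)%:R - 'C(n.*2, n + k.+2)%:R :> rat.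
Proof.
elim: n k => [|n IHn] k; first by rewrite M0; case: k => [|[]].
rewrite MS; case: k => [|k]; rewrite !IHn /= doubleS.
  have sym : 'C(n.*2.+1, n) = 'C(n.*2.+1, n.+1).
    by rewrite -bin_sub; [congr binomial|]; lia.
  rewrite !(addSn, addnS, addn0) binS sym !binS !natrD; ring.
rewrite !(addSn, addnS) !binS !natrD; ring.
Qed.

Lemma factSr n : n.+1`!%:R = n.+1%:R * n`!%:R :> rat.
Proof. by rewrite factS natrM. Qed.

Lemma factr_neq0 n : n`!%:R != 0 :> rat.
Proof. by rewrite pnatr_eq0 -lt0n fact_gt0. Qed.

Lemma bin_factr m n : 'C(m + n, m)%:R = (m + n)`!%:R / (m`!%:R * n`!%:R) :> rat.
Proof.
rewrite -(bin_fact (leq_addr n m)) addKn !natrM mulfK //.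
by rewrite mulf_neq0 ?factr_neq0.
Qed.

Lemma bin_step m n :
  'C(m + n, m.+1)%:R = n%:R / m.+1%:R * 'C(m + n, m)%:R :> rat.
Proof.
have /(congr1 (fun i => i%:R : rat)) := mul_bin_left (m + n) m.
by rewrite addKn !natrM mulrAC => <-; rewrite mulrC mulKf // pnatr_eq0.
Qed.

Lemma bin_step2 m n : 'C(m + n, m.+2)%:R =
  (n%:R - 1) / m.+2%:R * (n%:R / m.+1%:R) * 'C(m + n, m)%:R :> rat.
Proof.
(* For [n = 0] the factor [n%:R - 1] is -1, but the binomial and the factor [n%:R] are both 0. *)
case: n => [|n]; first by rewrite addn0 bin_small ?(mul0r, mulr0).
by rewrite -[RHS]mulrA -bin_step -addSnnS bin_step [n.+1%:R]mulrSr addrK.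
Qed.

(** With n = a + k, this is (2k+2)/(2n+2) times the binomial of 2n+2 over n-k, in factorials and
    free of natural subtraction. *)
Lemma M22_fact a k : M (a + k) k 2 2 =
  k.*2.+2%:R * (a + k).*2.+1`!%:R / (a`!%:R * (a + k.*2).+2`!%:R) :> rat.
Proof.
rewrite M22_bin; have -> : (a + k).*2 = (a + k.*2 + a)%N by lia.
have -> : (a + k + k = a + k.*2)%N by lia.
have -> : (a + k + k.+2 = (a + k.*2).+2)%N by lia.
rewrite bin_step2 bin_factr 3!factSr.
have := factr_neq0 a; have := factr_neq0 (a + k.*2).
move: (a + k.*2)`!%:R (a`!%:R) (a + k.*2 + a)`!%:R => A B C hA hB.
field; rewrite hA hB -!natrD nat1r !pnatr_eq0; lia.
Qed.

(* The factor [a] makes the formula valid for [a = 0], where both sides vanish. *)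
Lemma M22_next_fact a k : M (a + k) k.+1 2 2 =
  k.*2.+4%:R * a%:R * (a + k).*2.+1`!%:R / (a`!%:R * (a + k.*2).+3`!%:R) :> rat.
Proof.
case: a => [|a]; last first.
  rewrite addSnnS M22_fact doubleS !(addSn, addnS) [a.+1`!%:R]factSr.
  have := factr_neq0 a; have := factr_neq0 (a + k.*2).+4.
  move: (a + k.*2).+4`!%:R a`!%:R (a + k).+1.*2.+1`!%:R => A B C hA hB.
  by field; rewrite hA hB nat1r pnatr_eq0.
by rewrite M22_bin !bin_small ?(mulr0, mul0r, subr0) //; lia.
Qed.

Lemma det_M22_1 a k :
  M (a + k) k 2 2 * M (a + k).+1 k.+1 2 2
  - M (a + k) k.+1 2 2 * M (a + k).+1 k 2 2 =
  ((2 * k + 2) * (2 * k + 3) * (2 * k + 4))%:R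
  / ((2 * (a + k) + 2) * (2 * (a + k) + 3) * (2 * (a + k) + 4) ^ 2)%:R
  * 'C(2 * (a + k) + 4, a)%:R * 'C(2 * (a + k) + 4, a.+1)%:R :> rat.
Proof.
(* In row n + 1 the offset n - k stays [a] at column [k.+1] and becomes [a.+1] at column [k]. *)
rewrite -addnS (M22_fact a k.+1) addnS -addSn (M22_fact a.+1 k) addSn.
rewrite M22_next_fact M22_fact.
have -> : (2 * (a + k) + 4)%N = (a + (a + k.*2).+4)%N by lia.
rewrite bin_factr.
have -> : (a + (a + k.*2).+4 = a.+1 + (a + k.*2).+3)%N by lia.
rewrite bin_factr.
have -> : (a.+1 + (a + k.*2).+3 = (a + k).*2.+4)%N by lia.
rewrite !(addSn, addnS, doubleS).
rewrite !(factSr (a + k).*2.+3, factSr (a + k).*2.+2, factSr (a + k).*2.+1).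
rewrite !(factSr (a + k.*2).+3, factSr (a + k.*2).+2, factSr a).
have := factr_neq0 a; have := factr_neq0 (a + k.*2).+2.
(* All factorials are now multiples of three, which become nonzero or free atoms of a rational
   identity. *)
move: (a + k.*2).+2`!%:R a`!%:R (a + k).*2.+1`!%:R => A B C hA hB.
rewrite -!mul2n.
field.
by rewrite hA hB nat1r -!(natrM, natrD) !pnatr_eq0; lia.
Qed.

Lemma det_M22_2 a k :
  M (a + k) k 2 2 * M (a + k).+2 k.+1 2 2
  - M (a + k) k.+1 2 2 * M (a + k).+2 k 2 2 =
  2 * (((2 * k + 2) * (2 * k + 3) * (2 * k + 4))%:R
  / ((2 * (a + k) + 2) * (2 * (a + k) + 3)
     * (2 * (a + k) + 6) * (2 * (a + k) + 7))%:R
  * 'C(2 * (a + k) + 3, a)%:R * 'C(2 * (a + k) + 7, a.+2)%:R) :> rat.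
Proof.
have M1 := M22_fact a.+1 k.+1; have M2 := M22_fact a.+2 k.
rewrite !(addSn, addnS) in M1 M2; rewrite M1 M2 {M1 M2}.
rewrite M22_next_fact M22_fact.
have -> : (2 * (a + k) + 3)%N = (a + (a + k.*2).+3)%N by lia.
have -> : (2 * (a + k) + 7)%N = (a.+2 + (a + k.*2).+4.+1)%N by lia.
rewrite !bin_factr.
have -> : (a + (a + k.*2).+3 = (a + k).*2.+3)%N by lia.
have -> : (a.+2 + (a + k.*2).+4.+1 = (a + k).*2.+4.+3)%N by lia.
rewrite !(addSn, addnS, doubleS).
do !rewrite (factSr (a + k).*2.+1, factSr (a + k).*2.+2, factSr (a + k).*2.+3,
  factSr (a + k).*2.+4, factSr (a + k).*2.+4.+1, factSr (a + k).*2.+4.+2).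
do !rewrite (factSr (a + k.*2).+4, factSr (a + k.*2).+3, factSr (a + k.*2).+2,
  factSr a.+1, factSr a).
have := factr_neq0 a; have := factr_neq0 (a + k.*2).+2.
move: (a + k.*2).+2`!%:R a`!%:R (a + k).*2.+1`!%:R => A B C hA hB.
rewrite -!mul2n.
field.
by rewrite hA hB !nat1r -!(natrM, natrD) !pnatr_eq0; lia.
Qed.

Lemma M22_catalan n : M n 0 2 2 = catalan (n + 1).
Proof.
have := M22_fact n 0; rewrite double0 !addn0 => ->.
rewrite /catalan; have -> : (2 * (n + 1))%N = (n.+1 + n.+1)%N by lia.
rewrite addn1 bin_factr.
have -> : (n.+1 + n.+1)%N = n.*2.+2 by lia.
rewrite (factSr n.*2.+1) (factSr n.+1) (factSr n).
have := factr_neq0 n; move: n`!%:R n.*2.+1`!%:R => A B hA.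
rewrite -mul2n; field.
by rewrite hA !nat1r natr1 !pnatr_eq0.
Qed.

Theorem theorem4p4 (n : nat) :
  [/\ forall j : nat, j = 1%N \/ j = 2%N ->
        \sum_(0 <= k < n.+1) (-1) ^+ k *
          \det (mx22 (M n k 2 2) (M n (k + 1) 2 2)
                     (M (n + j) k 2 2) (M (n + j) (k + 1) 2 2))
        = 4 ^+ (j - 1) * catalan (n + 1),
      catalan (n + 1) =
        \sum_(0 <= k < n.+1) (-1) ^+ k *
          (((2 * k + 2) * (2 * k + 3) * (2 * k + 4))%:R
           / ((2 * n + 2) * (2 * n + 3) * (2 * n + 4) ^ 2)%:R)
          * 'C(2 * n + 4, n - k)%:R * 'C(2 * n + 4, n - k + 1)%:R
    & 2 * catalan (n + 1) =
        \sum_(0 <= k < n.+1) (-1) ^+ k *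
          (((2 * k + 2) * (2 * k + 3) * (2 * k + 4))%:R
           / ((2 * n + 2) * (2 * n + 3) * (2 * n + 6) * (2 * n + 7))%:R)
          * 'C(2 * n + 3, n - k)%:R * 'C(2 * n + 7, n - k + 2)%:R].
Proof.
(* (2 + A) e_0 = 2 e_0 + e_1 and (2 + A)^2 e_0 = 5 e_0 + 4 e_1 + e_2, whence the constants 1 and
   4. *)
have odd1 k : (iter 1 (up rat) 1)`_(k.*2.+1) = 1 *+ (k == 0%N).
  rewrite coef_iter_up.
  by case: k => [|k]; rewrite ?doubleS !(MS, M0) /=; ring.
have odd2 k : (iter 2 (up rat) 1)`_(k.*2.+1) = 4 *+ (k == 0%N).
  rewrite coef_iter_up.
  by case: k => [|k]; rewrite ?doubleS !(MS, M0) /=; ring.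
have sum1 := sum_det_M rat n 1 1 odd1; have sum2 := sum_det_M rat n 2 4 odd2.
rewrite M22_catalan in sum1 sum2; rewrite mul1r addn1 in sum1.
rewrite addn2 in sum2.
split.
- move=> j [] ->; under eq_bigr do rewrite addn1 det_mx22.
    by rewrite addn1 mul1r -sum1.
  by rewrite addn2 -sum2.
- rewrite addn1 -sum1; apply: eq_big_nat => k /andP[_]; rewrite ltnS => lekn.
  (* The four occurrences are the row indices of [M], put in the form a + k with a = n - k. *)
  by rewrite -{1 2 3 4}(subnK lekn) det_M22_1 !subnK // addn1 !mulrA.
(* [sum2] evaluates 4 times the Catalan number, and each determinant is twice the required
   summand. *)
have -> : 2 * catalan (n + 1) = 2^-1 * (4 * catalan (n + 1)).
  by field.
rewrite -sum2 mulr_sumr; apply: eq_big_nat => k /andP[_]; rewrite ltnS => lekn.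
rewrite -{1 2 3 4}(subnK lekn) det_M22_2 !subnK // (addn2 (n - k)).
by rewrite mulrCA mulKf // !mulrA.
Qed.
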